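(* Let $0\le p<q<1$. Then $CM(\ell^p,\ell^q)=\ell^p$. In particular, $(\ell^p,\ell^q)$ is not a Calderón–Mityagin couple.
   Context: All sequences are real. For $0<p<\infty$, $\|x\|_{\ell^p}=(\sum_k|x_k|^p)^{1/p}$; $\ell^0$ is the linear space of eventually zero sequences with $\|x\|_{\ell^0}:=\mathrm{card}\{k:x_k\ne0\}$. A map $T$ is bounded on $X$ if $\sup_{x\ne0}\|Tx\|_X/\|x\|_X<\infty$. For $0\le p<q$ (so $\ell^p\subset\ell^q$), $\mathfrak{L}(\ell^p,\ell^q)$ is the set of bounded linear operators $T$ on $\ell^q$ whose restriction to $\ell^p$ is a bounded map of $\ell^p$ into itself. For $x\in\ell^q$ and $t>0$, $\mathcal{K}(t,x;\ell^p,\ell^q):=\inf\{\|x_0\|_{\ell^p}+t\|x_1\|_{\ell^q}:x=x_0+x_1,\ x_0\in\ell^p,\ x_1\in\ell^q\}$. An element $y\in\ell^q=\ell^p+\ell^q$ is a Calderón–Mityagin element (CM-element) for $(\ell^p,\ell^q)$ if for every $x\in\ell^q$ satisfying $\mathcal{K}(t,y;\ell^p,\ell^q)\le\mathcal{K}(t,x;\ell^p,\ell^q)$ for all $t>0$ there exists $T\in\mathfrak{L}(\ell^p,\ell^q)$ with $Tx=y$. $CM(\ell^p,\ell^q)$ is the set of all CM-elements. $(\ell^p,\ell^q)$ is a Calderón–Mityagin couple if for every nonzero $x\in\ell^q$ and every $y\in\ell^q$ with $\sup_{t>0}\mathcal{K}(t,y;\ell^p,\ell^q)/\mathcal{K}(t,x;\ell^p,\ell^q)<\infty$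 there is $T\in\mathfrak{L}(\ell^p,\ell^q)$ with $y=Tx$. *)

(* Defs.v *)
From mathcomp Require Export all_boot all_order all_algebra.
From mathcomp Require Export all_classical all_reals all_analysis.

Set Implicit Arguments.
Unset Strict Implicit.
Unset Printing Implicit Defensive.

Import Order.TTheory GRing.Theory Num.Theory.

Local Open Scope classical_set_scope.
Local Open Scope ring_scope.

(* The library's [Lnorm] has no meaningful value at exponent 0, hence the case
   distinction. The value is +oo outside of the corresponding sequence space. *)
Definition lnorm (R : realType) (p : R) (x : nat -> R) : \bar R :=
  if p == 0 then counting [set k | x k != 0]
  else ('N[counting]_p%:E[EFin \o x])%E.

Definition ell (R : realType) (p : R) : set (nat -> R) :=
  if p == 0 then [set x | \forall k \near \oo, x k = 0]
  else [set x | (lnorm p x < +oo)%E].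

Definition linear_on (R : realType) (X : set (nat -> R))
    (T : (nat -> R) -> (nat -> R)) : Prop :=
  forall (a : R) (x y : nat -> R), X x -> X y ->
    T (fun k => a * x k + y k) = (fun k => a * T x k + T y k).

Definition bounded_on_ell (R : realType) (p : R)
    (T : (nat -> R) -> (nat -> R)) : Prop :=
  set_fun (ell p) (ell p) T /\
  (ereal_sup [set lnorm p (T x) / lnorm p x |
     x in [set x | ell p x /\ x <> cst 0%R]] < +oo)%E.

(* An operator on ell q is represented by a map on all sequences, whose values
   outside of ell q are irrelevant. *)
Definition ell_operators (R : realType) (p q : R) :
    set ((nat -> R) -> (nat -> R)) :=
  [set T | [/\ linear_on (ell q) T, bounded_on_ell q T & bounded_on_ell p T]].

Definition Kfunctional (R : realType) (p q t : R) (x : nat -> R) : \bar R :=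
  ereal_inf [set (lnorm p u.1 + t%:E * lnorm q u.2)%E | u in
    [set u : (nat -> R) * (nat -> R) |
      [/\ ell p u.1, ell q u.2 & x = (fun k => u.1 k + u.2 k)]]].

Definition CM (R : realType) (p q : R) : set (nat -> R) :=
  [set y | ell q y /\
    forall x, ell q x ->
      (forall t : R, 0 < t -> (Kfunctional p q t y <= Kfunctional p q t x)%E) ->
      exists2 T, ell_operators p q T & T x = y].

Definition CM_couple (R : realType) (p q : R) : Prop :=
  forall x y : nat -> R, ell q x -> x <> cst 0 -> ell q y ->
    (ereal_sup [set Kfunctional p q t y / Kfunctional p q t x |
       t in [set t : R | (0 < t)%R]] < +oo)%E ->
    exists2 T, ell_operators p q T & y = T x.

(* Main.v *)
Require Import Defs.
From mathcomp Require Import ring lra.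

(** The inclusion of [ell p] in [CM p q] is cheap: if [y] is in [ell p] and
    nonzero, then an [x] whose K-functional is at least that of [y] has a nonzero
    entry [x k], and the rank one operator sending [z] to [(z k / x k) y] is
    bounded on both spaces and maps [x] to [y].

    For the converse, let [y] be in [ell q] but not in [ell p]. An operator on
    [ell q] sends the unit vectors to uniformly bounded sequences, so it bounds
    the sup norm of an image by the l^1 norm ([sup_norm_bounded_by_sum]). But for
    [q < 1] a sequence that is large in [ell q] can be tiny in l^1. So one looks
    for an [x] which dominates [y] for the K-functional and whose tails are minute
    in l^1. Such an [x] is built from consecutive constant blocks, block [j] having
    height [h j] and length [N j].
    As [p < q < 1], for a fixed value of [N (h ^ q)] the quantity [N (h ^ p)] is
    as large as desired and [N h] as small as desired when [h] is small
    ([block_parameters]).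

    Domination ([dominating_split]): cut [y] at indices [n j] with [n 0 = 0] such
    that the tails decrease geometrically in [ell q]. Block [j] is made at least
    as big in [ell q] as the tail of [y] from [n j] on, and at least as big in
    [ell p] as the head of [y] up to [n (j+1)]. If [x = u + v], then on every
    block either [u] or [v] carries half of its size. At the first block [j]
    where [v] does, [v] dominates the tail of [y] from [n j] on, whereas [u]
    dominates the head up to [n j] because of block [j - 1]. Splitting [y] at
    [n j] therefore costs no more than splitting [x] into [u] and [v], for every
    [t] at once.

    No operator ([dominating_sequence]): balls of [ell p] are closed under
    coordinatewise convergence, so [y] has positive sup distance to each of them
    ([uniform_distance_to_balls]). The block heights are chosen recursively so
    that the l^1 norm of what follows the first [j] blocks is negligible against
    the sup distance from [y] to the ball whose radius is [j + 1] times the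
    [ell p] size of these blocks. If [T x = y] with [T] bounded on both spaces,
    take [j] beyond the bounds of [T]: the image of the first [j] blocks lies in
    this ball, and the image of the rest is too small in the sup norm to bring it
    to [y].

    The case [p = 0] needs no separate treatment: sizes and radii are
    measured by the modular, the sum of [|x k| ^ p] over the nonzero entries, which
    is the p-th power of the norm if [p > 0] and the size of the support if
    [p = 0].

    Finally [ell q] is larger than [ell p], again by a block sequence, so some [y]
    is not a CM-element, and the [x] found for it refutes the couple property. *)
Set Implicit Arguments.
Unset Strict Implicit.
Unset Printing Implicit Defensive.

Import Order.TTheory GRing.Theory Num.Theory.
Import numFieldNormedType.Exports.

Local Open Scope classical_set_scope.
Local Open Scope ring_scope.

(** * Modulars of sequences *)

Section modular.
Context {R : realType}.
Implicit Types (p q a b C M : R) (x y z u v : nat -> R).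

(** Putting [gauge p 0 = 0] is what makes [p = 0] fit in, where the power of [0]
    with exponent [0] would be [1]: [gauge 0] is the indicator of nonzero reals. *)
Definition gauge p a : R := if a == 0 then 0 else `|a| `^ p.

Lemma gauge0 p : gauge p 0 = 0.
Proof. by rewrite /gauge eqxx. Qed.

Lemma gauge1 p : gauge p 1 = 1.
Proof. by rewrite /gauge oner_eq0 normr1 powR1. Qed.

Lemma gauge_ge0 p a : 0 <= gauge p a.
Proof. by rewrite /gauge; case: ifP => // _; exact: powR_ge0. Qed.

Lemma gauge_gt0 p a : a != 0 -> 0 < gauge p a.
Proof. by move=> a0; rewrite /gauge (negbTE a0) powR_gt0// normr_gt0. Qed.

Lemma gauge_powR p a : 0 < p -> gauge p a = `|a| `^ p.
Proof.
by rewrite /gauge; case: eqVneq => // -> p0; rewrite normr0 powR0// gt_eqF.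
Qed.

Lemma gaugeM p a b : gauge p (a * b) = gauge p a * gauge p b.
Proof.
rewrite /gauge mulf_eq0; case: eqVneq => [|a0]; first by rewrite mul0r.
case: eqVneq => [|b0]; first by rewrite mulr0.
by rewrite /= normrM powRM.
Qed.

Lemma le_gauge p a b : 0 <= p -> `|a| <= `|b| -> gauge p a <= gauge p b.
Proof.
move=> p0 ab; have [->|a0] := eqVneq a 0; first by rewrite gauge0 gauge_ge0.
have b0 : b != 0 by rewrite -normr_gt0 (lt_le_trans _ ab)// normr_gt0.
by rewrite /gauge (negbTE a0) (negbTE b0) ge0_ler_powR ?nnegrE.
Qed.

(** Half of an entry keeps half of its gauge, as [2 ^ p <= 2]; this replaces any
    continuity argument for the gauge, which is discontinuous for [p = 0]. *)
Lemma gauge_le_double_half p a : p <= 1 -> gauge p a <= 2 * gauge p (a / 2).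
Proof.
move=> p1; rewrite gaugeM mulrCA ler_peMr ?gauge_ge0//.
rewrite /gauge invr_eq0 pnatr_eq0/= normfV ger0_norm//.
rewrite -ler_pdivrMl// mulr1 -{1}(@powRr1 _ 2^-1)//.
by apply: ger_powR => //; rewrite invr_gt0 ltr0n invf_le1 ?ler1n.
Qed.

Lemma gauge_lt1 p a : 0 <= p -> gauge p a < 1 -> `|a| < 1.
Proof.
move=> p0; apply: contraTT; rewrite -!leNgt => a1.
by rewrite -(gauge1 p) le_gauge// normr1.
Qed.

Lemma le_gauge_exponent p q a : p <= q -> `|a| <= 1 -> gauge q a <= gauge p a.
Proof.
move=> pq a1; rewrite /gauge; case: eqVneq => // a0.
by apply: ger_powR => //; rewrite normr_gt0 a0.
Qed.

Lemma ereal_lt_pinfty_le (s : \bar R) : (s < +oo)%E ->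
  exists2 M, 0 < M & (s <= M%:E)%E.
Proof.
case: s => [r _||_]; [|by []|by exists 1; rewrite ?ltr01 ?leNye].
exists (Num.max r 1); first by rewrite lt_max ltr01 orbT.
by rewrite lee_fin le_max lexx.
Qed.

Definition modular p x : \bar R := (\sum_(k <oo) (gauge p (x k))%:E)%E.

Lemma modular_ge0 p x : (0 <= modular p x)%E.
Proof. by apply: nneseries_ge0 => k _ _; rewrite lee_fin gauge_ge0. Qed.

Lemma modular_leP p x M :
  (modular p x <= M%:E)%E <-> forall n, \sum_(0 <= k < n) gauge p (x k) <= M.
Proof.
split=> [xM n|xM].
  rewrite -lee_fin (le_trans _ xM)// -sumEFin.
  by apply: nneseries_lim_ge => k _ _; rewrite lee_fin gauge_ge0.
apply: lime_le.
  by apply: is_cvg_nneseries => k _ _; rewrite lee_fin gauge_ge0.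
by apply: nearW => n; rewrite sumEFin lee_fin.
Qed.

Lemma sum_le_modular p x n :
  ((\sum_(0 <= k < n) gauge p (x k))%:E <= modular p x)%E.
Proof.
rewrite -sumEFin; apply: nneseries_lim_ge => k _ _.
by rewrite lee_fin gauge_ge0.
Qed.

Lemma gauge_le_modular p x k : ((gauge p (x k))%:E <= modular p x)%E.
Proof.
apply: le_trans (sum_le_modular p x k.+1); rewrite lee_fin big_nat_recr//=.
by rewrite lerDr sumr_ge0// => i _; exact: gauge_ge0.
Qed.

Lemma le_modular p x y : 0 <= p -> (forall k, `|x k| <= `|y k|) ->
  (modular p x <= modular p y)%E.
Proof.
move=> p0 xy; apply: lee_nneseries => k _; rewrite lee_fin.
  by rewrite gauge_ge0.
by apply: le_gauge.
Qed.

Lemma modularZ p a x :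
  modular p (fun k => a * x k) = ((gauge p a)%:E * modular p x)%E.
Proof.
rewrite -nneseriesZl; last by move=> k _; rewrite lee_fin gauge_ge0.
by apply: eq_eseriesr => k _; rewrite gaugeM EFinM.
Qed.

Lemma modular_cst0 p : modular p (cst 0) = 0%E.
Proof. by apply: eseries0 => k _ _; rewrite gauge0. Qed.

Lemma eq_cst0P x : x <> cst 0 <-> exists k, x k != 0.
Proof.
split=> [x0|[k xk] x0]; last by rewrite x0 eqxx in xk.
apply: contra_notP x0 => /forallNP x0; apply/funext => k.
by apply/eqP; rewrite -[_ == _]negbK; exact/negP/x0.
Qed.

Lemma modular_gt0 p x : x <> cst 0 -> (0 < modular p x)%E.
Proof.
move=> /eq_cst0P[k xk].
by rewrite (lt_le_trans _ (gauge_le_modular p x k))// lte_fin gauge_gt0.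
Qed.

Lemma modular_lnorm p x : 0 <= p ->
  modular p x = if p == 0 then lnorm p x else (lnorm p x `^ p)%E.
Proof.
rewrite /lnorm le_eqVlt eq_sym; case: eqVneq => [-> _|p0 /= p_gt0].
  rewrite counting_dirac; apply: eq_eseriesr => k _.
  rewrite /dirac indicE /gauge; case: eqVneq => xk.
    by rewrite memNset//= xk eqxx.
  by rewrite mem_set// powRr0.
rewrite poweR_Lnorm// ge0_integral_count//; last by move=> k; exact: poweR_ge0.
by apply: eq_eseriesr => k _; rewrite gauge_powR.
Qed.

Lemma lnorm_ge0 p x : (0 <= lnorm p x)%E.
Proof. by rewrite /lnorm; case: ifP => _ //; exact: Lnorm_ge0. Qed.

Lemma lnorm_modular p x : 0 <= p ->
  lnorm p x = if p == 0 then modular p x else (modular p x `^ p^-1)%E.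
Proof.
move=> p0; rewrite modular_lnorm//; case: (eqVneq p 0) => //= pn0.
by rewrite -poweRrM divff// poweRe1// lnorm_ge0.
Qed.

Lemma modular_finite_support p x n : (forall k, (n <= k)%N -> x k = 0) ->
  modular p x = (\sum_(0 <= k < n) gauge p (x k))%:E.
Proof.
move=> xn; rewrite /modular (nneseries_split 0 n); last first.
  by move=> k _; rewrite lee_fin gauge_ge0.
by rewrite !add0n eseries0 ?adde0 ?sumEFin// => k nk _; rewrite xn ?gauge0.
Qed.

(** For [p = 0] this says that almost all entries vanish, for [p > 0] that almost
    all are less than [1]. *)
Lemma near_gauge_lt1 p x : (modular p x < +oo)%E ->
  \forall k \near \oo, gauge p (x k) < 1.
Proof.
move=> /ereal_lt_pinfty_le[M M0 /modular_leP xM].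
have /cvg_series_cvg_0 /cvgrPdist_lt/(_ 1 ltr01) : cvgn (series (gauge p \o x)).
  apply: nondecreasing_is_cvgn.
    by apply: nondecreasing_series => k _ _; exact: gauge_ge0.
  by exists M => _ [n _ <-]; exact: xM.
by apply: filterS => k; rewrite sub0r normrN ger0_norm// gauge_ge0.
Qed.

Lemma ell_modular p x : 0 <= p -> ell p x <-> (modular p x < +oo)%E.
Proof.
move=> p0; rewrite /ell; case: (eqVneq p 0) => [->|pn0] /=; last first.
  rewrite lnorm_modular// (negbTE pn0); split; last exact: poweR_lty.
  by apply: lty_poweRy; rewrite invr_neq0.
split=> [[n _ xn]|/near_gauge_lt1].
  by rewrite (@modular_finite_support 0 x n)// ltry.
apply: filterS => k; rewrite /gauge; case: eqVneq => // _.
by rewrite powRr0 ltxx.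
Qed.

Lemma lnorm_gt0 p x : 0 <= p -> x <> cst 0 -> (0 < lnorm p x)%E.
Proof.
move=> p0 x0; rewrite lnorm_modular//; case: ifP => _; first exact: modular_gt0.
by apply: poweR_gt0; exact: modular_gt0.
Qed.

Lemma lnorm_lty p x : 0 <= p -> ell p x -> (lnorm p x < +oo)%E.
Proof.
move=> p0; rewrite ell_modular// lnorm_modular//; case: ifP => // _.
exact: poweR_lty.
Qed.

Lemma lnorm_cst0 p : 0 <= p -> lnorm p (cst (0 : R)) = 0%E.
Proof.
move=> p0; rewrite lnorm_modular// modular_cst0; case: ifPn => // p_neq0.
by rewrite poweR0r// invr_neq0.
Qed.

(** The quotient of extended reals behaves as expected here since the norm of [y]
    is positive and finite. *)
Lemma lnorm_div_le p x y M : 0 <= p -> ell p y -> y <> cst 0 ->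
  (lnorm p x / lnorm p y <= M%:E)%E = (lnorm p x <= M%:E * lnorm p y)%E.
Proof.
move=> p0 yp y0; have := lnorm_gt0 p0 y0; have := lnorm_lty p0 yp.
case: (lnorm p y) => // r _; rewrite lte_fin => r0.
by rewrite inver gt_eqF// lee_pdivrMr.
Qed.

Lemma le_lnorm p x y : 0 <= p -> (modular p x <= modular p y)%E ->
  (lnorm p x <= lnorm p y)%E.
Proof.
move=> p0 xy; rewrite !lnorm_modular//; case: ifP => // _.
by apply: gt0_ler_poweR => //; rewrite ?invr_ge0// in_itv/= modular_ge0 leey.
Qed.

Definition cut_head n x k : R := if (k < n)%N then x k else 0.
Definition cut_tail n x k : R := if (k < n)%N then 0 else x k.

Lemma headDtail n x : (fun k => cut_head n x k + cut_tail n x k) = x.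
Proof.
apply/funext => k; rewrite /cut_head /cut_tail.
by case: ifP => _; rewrite ?addr0 ?add0r.
Qed.

Lemma normr_tail_le n x k : `|cut_tail n x k| <= `|x k|.
Proof. by rewrite /cut_tail; case: ifP; rewrite ?normr0. Qed.

Lemma modular_head p n x :
  modular p (cut_head n x) = (\sum_(0 <= k < n) gauge p (x k))%:E.
Proof.
rewrite (@modular_finite_support _ _ n) => [|k nk]; last first.
  by rewrite /cut_head ltnNge nk.
by congr (_%:E); apply: eq_big_nat => k /andP[_ kn]; rewrite /cut_head kn.
Qed.

Lemma ell_head p n x : 0 <= p -> ell p (cut_head n x).
Proof. by move=> p0; rewrite ell_modular// modular_head ltry. Qed.

Lemma ell_tail p n x : 0 <= p -> ell p x -> ell p (cut_tail n x).
Proof.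
move=> p0; rewrite !ell_modular//; apply: le_lt_trans.
by apply: le_modular => // k; exact: normr_tail_le.
Qed.

Lemma sub_ell p q : 0 <= p -> p <= q -> ell p `<=` (ell q : set (nat -> R)).
Proof.
move=> p0 pq x; rewrite !ell_modular//; last exact: le_trans pq.
move=> xp; have [n _ xn] := near_gauge_lt1 xp.
have [M _ /modular_leP xM] := ereal_lt_pinfty_le xp.
apply: (@le_lt_trans _ _ (M + \sum_(0 <= k < n) gauge q (x k))%:E); last first.
  by rewrite ltry.
apply/modular_leP => m.
apply: (@le_trans _ _
  (\sum_(0 <= k < m) (gauge p (x k) + gauge q (cut_head n x k)))).
  apply: ler_sum => k _; rewrite /cut_head; case: ltnP => [_|nk].
    by rewrite lerDr gauge_ge0.
  by rewrite gauge0 addr0 le_gauge_exponent// ltW// (@gauge_lt1 p)// xn.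
rewrite big_split lerD//=.
by rewrite -lee_fin -(modular_head q n x); exact: sum_le_modular.
Qed.

(** Boundedness can be tested on modulars: for [p > 0] the constant is raised to
    the power [p]. That [T] vanishes at [0] settles the one sequence that the
    supremum of the quotients leaves out. *)
Lemma bounded_on_ell_modular p (T : (nat -> R) -> (nat -> R)) : 0 <= p ->
  T (cst 0) = cst 0 ->
  bounded_on_ell p T <->
  exists2 C, 0 < C & forall x, ell p x ->
    (modular p (T x) <= C%:E * modular p x)%E.
Proof.
move=> p0 T0; split=> [[_ Tp]|[C C0 CT]].
  have [c c0 cT] : exists2 c, 0 < c & forall x, ell p x ->
      (lnorm p (T x) <= c%:E * lnorm p x)%E.
    have [c c0 Tc] := ereal_lt_pinfty_le Tp; exists c => // x xp.
    have [->|x0] := pselect (x = cst 0); first by rewrite T0 lnorm_cst0 ?mule0.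
    rewrite -lnorm_div_le//; apply: le_trans Tc.
    by apply: ereal_sup_ubound; exists x.
  case: (eqVneq p 0) => pn0.
    by exists c => // x xp; rewrite !modular_lnorm// pn0 eqxx -pn0; exact: cT.
  exists (c `^ p) => [|x xp]; first by rewrite powR_gt0.
  rewrite !modular_lnorm// (negbTE pn0) -poweR_EFin -poweRM ?lnorm_ge0//.
    apply: gt0_ler_poweR; rewrite ?in_itv/= ?leey ?andbT ?lnorm_ge0//.
      by rewrite mule_ge0 ?lnorm_ge0 ?lee_fin 1?ltW.
    exact: cT.
  by rewrite lee_fin ltW.
split=> [x xp|].
  apply/ell_modular => //; apply: le_lt_trans (CT _ xp) _.
  move/ell_modular : xp => /(_ p0)/ereal_lt_pinfty_le[M M0 xM].
  apply: le_lt_trans (lee_wpmul2l _ xM) _; rewrite ?lee_fin ?ltW//.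
  by rewrite -EFinM ltry.
pose c := if p == 0 then C else C `^ p^-1.
apply: (@le_lt_trans _ _ c%:E); last by rewrite ltry.
apply: ge_ereal_sup => _ [x [xp x0] <-]; rewrite lnorm_div_le//.
rewrite /c !lnorm_modular//; case: ifP => _; first exact: CT.
have C_ge0 : (0 <= C%:E)%E by rewrite lee_fin ltW.
rewrite -poweR_EFin -poweRM ?modular_ge0//.
apply: gt0_ler_poweR; rewrite ?in_itv/= ?leey ?andbT ?invr_ge0//.
- exact: modular_ge0.
- by rewrite mule_ge0 ?modular_ge0.
- exact: CT.
Qed.

End modular.

(** * The K-functional and the easy inclusion *)

Section Kfunctional_easy.
Context {R : realType}.
Implicit Types (p q t a b C M : R) (x y z u v : nat -> R).

(** A comparison of decompositions that does not depend on [t] yields the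
    domination of K-functionals for all [t]. *)
Lemma Kfunctional_le p q x y : 0 <= p -> 0 <= q ->
  (forall u v, ell p u -> ell q v -> x = (fun k => u k + v k) ->
    exists u' v', [/\ y = (fun k => u' k + v' k),
      (modular p u' <= modular p u)%E & (modular q v' <= modular q v)%E]) ->
  forall t, 0 < t -> (Kfunctional p q t y <= Kfunctional p q t x)%E.
Proof.
move=> p0 q0 xy t t0; apply: le_ereal_inf_tmp => _ [[u v] /= [up vq xuv] <-].
have [u' [v' [yuv u'u v'v]]] := xy _ _ up vq xuv.
apply: le_trans (leeD (le_lnorm p0 u'u) (lee_wpmul2l _ (le_lnorm q0 v'v))).
  apply: ereal_inf_lbound; exists (u', v') => //; split=> //=.
    by move: up; rewrite !ell_modular//; exact: le_lt_trans.
  by move: vq; rewrite !ell_modular//; exact: le_lt_trans.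
by rewrite lee_fin ltW.
Qed.

Lemma Kfunctional_ge0 p q t x : 0 < t -> (0 <= Kfunctional p q t x)%E.
Proof.
move=> t0; apply: le_ereal_inf_tmp => _ [[u v] _ <-].
by rewrite adde_ge0 ?mule_ge0 ?lnorm_ge0 ?lee_fin 1?ltW.
Qed.

Lemma Kfunctional_cst0 p q t : 0 <= p -> 0 <= q ->
  (Kfunctional p q t (cst 0%R) <= 0)%E.
Proof.
move=> p0 q0; apply: ereal_inf_lbound; exists (cst 0, cst 0).
  split=> /=; try by apply/ell_modular => //; rewrite modular_cst0 ltry.
  by apply/funext => k; rewrite addr0.
by rewrite /= !lnorm_cst0// mule0 adde0.
Qed.

(** If [x k] is nonzero, then for each decomposition one of the two summands is
    at least half as large as [x] at [k]. *)
Lemma Kfunctional_gt0 p q t x : 0 <= p -> 0 <= q -> 0 < t -> x <> cst 0 ->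
  (0 < Kfunctional p q t x)%E.
Proof.
move=> p0 q0 t0 /eq_cst0P[k xk0].
(* a lower bound that is common to all decompositions *)
pose d := (fun i => if i == k then x k / 2 else 0) : nat -> R.
have d0 : d <> cst 0.
  move=> /(congr1 (fun f => f k)); rewrite /d eqxx /= => /eqP.
  by rewrite mulf_eq0 (negbTE xk0) invr_eq0 pnatr_eq0.
have dle r u : 0 <= r -> `|x k| / 2 <= `|u k| -> (lnorm r d <= lnorm r u)%E.
  move=> r0 xu; apply: le_lnorm => //; apply: le_modular => // i.
  rewrite /d; case: eqP => [->|_]; last by rewrite normr0.
  by rewrite normrM normfV (ger0_norm (ler0n _ 2)).
apply: (@lt_le_trans _ _ (Order.min (lnorm p d) (t%:E * lnorm q d)%E)).
  by rewrite lt_min lnorm_gt0//= mule_gt0// ?lte_fin// lnorm_gt0.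
apply: le_ereal_inf_tmp => _ [[u v] /= [_ _ xuv] <-].
have tv0 w : (0 <= t%:E * lnorm q w)%E.
  by rewrite mule_ge0 ?lnorm_ge0 ?lee_fin 1?ltW.
have [ku|ku] := leP (`|x k| / 2) `|u k|.
  by rewrite ge_min (le_trans (dle _ _ p0 ku))// leeDl.
rewrite ge_min orbC (@le_trans _ _ (t%:E * lnorm q v)%E)//; last first.
  by rewrite leeDr// lnorm_ge0.
apply: lee_wpmul2l; first by rewrite lee_fin ltW.
apply: dle => //; move: ku; rewrite xuv; have := ler_normD (u k) (v k); lra.
Qed.

Lemma linear_on_cst0 (X : set (nat -> R)) T : linear_on X T -> X (cst 0) ->
  T (cst 0) = cst 0.
Proof.
move=> TX X0; have := TX (-1) _ _ X0 X0.
rewrite (_ : (fun=> _) = cst 0) => [->|]; apply/funext => k /=.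
  by rewrite mulN1r addNr.
by rewrite mulr0 addr0.
Qed.

Lemma ell_cst0 p : 0 <= p -> ell p (cst (0 : R)).
Proof. by move=> p0; apply/ell_modular => //; rewrite modular_cst0 ltry. Qed.

Lemma rank_one_operators p q k a y : 0 <= p -> p <= q -> ell p y ->
  ell_operators p q (fun x i => a * x k * y i).
Proof.
move=> p0 pq yp; set T := (X in ell_operators p q X).
have q0 := le_trans p0 pq.
have T0 : T (cst 0) = cst 0.
  by apply/funext => i; rewrite /T /= mulr0 mul0r.
have Tb r : 0 <= r -> ell r y -> bounded_on_ell r T.
  move=> r0 /(ell_modular _ r0)/ereal_lt_pinfty_le[M M0 yM].
  apply/bounded_on_ell_modular => //; exists (gauge r a * M + 1).
    by rewrite ltr_wpDl// mulr_ge0 ?gauge_ge0// ltW.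
  move=> x _; rewrite /T modularZ gaugeM.
  apply: le_trans (lee_wpmul2l _ yM) _.
    by rewrite lee_fin mulr_ge0 ?gauge_ge0.
  apply: (@le_trans _ _ ((gauge r a * M)%:E * modular r x)%E); last first.
    by rewrite lee_wpmul2r ?modular_ge0// lee_fin lerDl.
  rewrite -EFinM mulrAC EFinM lee_wpmul2l ?gauge_le_modular//.
  by rewrite lee_fin mulr_ge0 ?gauge_ge0 1?ltW.
split; [|exact: Tb (sub_ell p0 pq yp)|exact: Tb].
by move=> b x z _ _; apply/funext => i; rewrite /T; ring.
Qed.

Lemma ell_sub_CM p q : 0 <= p -> p < q -> ell p `<=` (CM p q : set (nat -> R)).
Proof.
move=> p0 pq y yp; have q0 := le_trans p0 (ltW pq).
split=> [|x xq Kyx]; first exact: sub_ell (ltW pq) _ yp.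
have [->|y0] := pselect (y = cst 0).
  exists (fun=> cst 0) => //.
  rewrite (_ : (fun=> _) = (fun x i => 0 * x 0 * cst 0 i)); last first.
    by apply/funext => z; apply/funext => i; rewrite !mul0r.
  by apply: rank_one_operators => //; [exact: ltW|exact: ell_cst0].
have /eq_cst0P[k xk] : x <> cst 0.
  move=> x0; have := Kyx 1 ltr01; rewrite x0 leNgt => /negP; apply.
  by rewrite (le_lt_trans (Kfunctional_cst0 _ _ _))// Kfunctional_gt0.
exists (fun z i => (x k)^-1 * z k * y i).
  by apply: rank_one_operators => //; exact: ltW.
by apply/funext => i; rewrite mulVf// mul1r.
Qed.

End Kfunctional_easy.

(** * Sup norms of images and distances to balls *)

Section sup_norm.
Context {R : realType}.
Implicit Types (p q t a b C M : R) (x y z u v : nat -> R).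

Lemma modular_tail p n x :
  modular p (cut_tail n x) = (\sum_(n <= k <oo) (gauge p (x k))%:E)%E.
Proof.
rewrite eseries_cond eseries_mkcondr; apply: eq_eseriesr => k _.
by rewrite /cut_tail; case: ltnP => _ //=; rewrite gauge0.
Qed.

Lemma modular_tail_small p x e : (modular p x < +oo)%E -> 0 < e ->
  exists n, (modular p (cut_tail n x) <= e%:E)%E.
Proof.
move=> xp e0.
have x_ge0 k : xpredT k -> (0 <= (gauge p (x k))%:E)%E.
  by rewrite lee_fin gauge_ge0.
have /fine_cvgP[fin /cvgrPdist_le/(_ e e0) small] := nneseries_tail_cvg xp x_ge0.
have [n _ /(_ n (leqnn n)) [fn sn]] := filterI fin small.
exists n; rewrite modular_tail -(fineK fn) lee_fin.
by apply: le_trans (ler_norm _) _; rewrite -normrN -sub0r.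
Qed.

Lemma linear_on_headDtail q (T : (nat -> R) -> (nat -> R)) x n m : 0 <= q ->
  linear_on (ell q) T -> ell q x ->
  T x m = T (cut_head n x) m + T (cut_tail n x) m.
Proof.
move=> q0 Tlin xq; rewrite -{1}(headDtail n x).
have := Tlin 1 _ _ (ell_head n x q0) (ell_tail n q0 xq).
under [X in T X]eq_fun do rewrite mul1r.
by move=> ->; rewrite mul1r.
Qed.

(** By linearity a coordinate of the image of a finitely supported [x] is a
    combination of coordinates of images of unit vectors, which are uniformly
    bounded. Boundedness on [ell q] removes the remaining tail. *)
Lemma sup_norm_bounded_by_sum q (T : (nat -> R) -> (nat -> R)) : 0 < q ->
  linear_on (ell q) T -> bounded_on_ell q T ->
  exists2 C, 0 < C & forall x B, ell q x ->
    (forall n, \sum_(0 <= k < n) `|x k| <= B) -> forall m, `|T x m| <= C * B.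
Proof.
move=> q_gt0 Tlin Tb; have q0 := ltW q_gt0.
have T0 : T (cst 0) = cst 0 by apply: linear_on_cst0 Tlin _; exact: ell_cst0.
have [C C0 TC] := (bounded_on_ell_modular q0 T0).1 Tb.
pose delta k : nat -> R := fun i => (i == k)%:R.
have modular_delta k : modular q (delta k) = 1%E.
  rewrite (@modular_finite_support _ _ _ k.+1) => [|i ki]; last first.
    by rewrite /delta gtn_eqF.
  rewrite big_nat_recr//= /delta eqxx gauge1 big_nat big1 ?add0r// => i.
  by move=> /andP[_ ik]; rewrite ltn_eqF// gauge0.
have ell_delta k : ell q (delta k).
  by apply/ell_modular => //; rewrite modular_delta ltry.
have coord z e m : 0 < e -> (modular q z <= (e `^ q)%:E)%E -> `|z m| <= e.
  move=> e0 /(le_trans (gauge_le_modular q z m)); rewrite lee_fin.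
  rewrite gauge_powR//; apply: contraTT; rewrite -!ltNge => ze.
  by apply: gt0_ltr_powR => //; rewrite nnegrE ltW.
have Cq : (C `^ q^-1) `^ q = C by rewrite -powRrM mulVf ?gt_eqF// powRr1// ltW.
exists (C `^ q^-1) => [|x B xq xB m]; first exact: powR_gt0.
(* all unit vectors have modular [1], whence one bound for their images *)
have Tdelta k : `|T (delta k) m| <= C `^ q^-1.
  apply: coord; first exact: powR_gt0.
  by rewrite Cq (le_trans (TC _ _))// modular_delta mule1.
have Thead n : `|T (cut_head n x) m| <= C `^ q^-1 * \sum_(0 <= k < n) `|x k|.
  elim: n => [|n ih].
    have -> : cut_head 0 x = cst 0 by exact/funext.
    by rewrite T0 normr0 big_nil mulr0.
  rewrite (_ : cut_head n.+1 x =
    fun k => x n * delta n k + cut_head n x k); last first.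
    apply/funext => k; rewrite /cut_head /delta ltnS.
    by case: ltngtP => [||->]; rewrite ?mulr0 ?mulr1 ?add0r ?addr0.
  rewrite Tlin//; last exact: ell_head.
  rewrite big_nat_recr//= mulrDr; apply: le_trans (ler_normD _ _) _.
  by rewrite [leLHS]addrC lerD// normrM mulrC ler_wpM2r.
apply/ler_addgt0Pr => e e0.
have eC0 : 0 < e `^ q / C by rewrite divr_gt0 ?powR_gt0.
have [n xn] := modular_tail_small ((ell_modular _ q0).1 xq) eC0.
rewrite (linear_on_headDtail n m q0 Tlin xq).
apply: le_trans (ler_normD _ _) _; apply: lerD.
  by rewrite (le_trans (Thead n))// ler_wpM2l ?powR_ge0.
apply: coord => //; apply: le_trans (TC _ (ell_tail _ q0 xq)) _.
apply: le_trans (lee_wpmul2l _ xn) _; first by rewrite lee_fin ltW.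
by rewrite -EFinM mulrCA divff ?mulr1// gt_eqF.
Qed.

Lemma uniform_lower_bound y m : exists2 d, 0 < d &
  forall k, (k < m)%N -> y k != 0 -> d <= `|y k|.
Proof.
elim: m => [|m [d d0 dy]]; first by exists 1.
exists (if y m == 0 then d else Num.min d `|y m|).
  by case: eqVneq => // ym; rewrite lt_min d0 normr_gt0.
move=> k; rewrite ltnS leq_eqVlt => /predU1P[->|km] yk.
  by rewrite (negbTE yk) ge_min lexx orbT.
by case: ifP => _; rewrite ?ge_min dy.
Qed.

(** Finitely many entries of [y] already have a modular above [2 B]. A sequence
    that differs from [y] by at most half of each nonzero one among these entries
    retains half of their gauges. *)
Lemma uniform_distance_to_balls p y : 0 <= p -> p <= 1 -> ~ ell p y ->
  forall B, exists2 d, 0 < d & forall u, (forall k, `|y k - u k| <= d) ->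
    (B%:E < modular p u)%E.
Proof.
move=> p0 p1 yp B.
have [m ym] : exists m, 2 * B < \sum_(0 <= k < m) gauge p (y k).
  apply: contra_notP yp => /forallNP yB; apply/ell_modular => //.
  apply: (@le_lt_trans _ _ (2 * B)%:E); last by rewrite ltry.
  by apply/modular_leP => n; rewrite leNgt; exact/negP/yB.
have [d d0 dy] := uniform_lower_bound y m.
exists (d / 2) => [|u yu]; first by rewrite divr_gt0.
apply: lt_le_trans (sum_le_modular p u m); rewrite lte_fin.
rewrite -(@ltr_pM2l _ 2)//; apply: lt_le_trans ym _; rewrite mulr_sumr.
apply: ler_sum_nat => k /andP[_ km].
have [->|yk] := eqVneq (y k) 0; first by rewrite gauge0 mulr_ge0 ?gauge_ge0.
apply: le_trans (gauge_le_double_half _ p1) _.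
rewrite ler_pM2l// le_gauge// normrM normfV (ger0_norm (ler0n _ 2)).
have := dy _ km yk; have := yu k; have := ler_normD (y k - u k) (u k).
by rewrite subrK; lra.
Qed.

End sup_norm.

(** * Sequences made of constant blocks *)

Section blocks.
Context {R : realType}.
Implicit Types (p q t a b c C M : R) (h x y z u v : nat -> R) (N : nat -> nat).

Lemma powR_small (s b : R) : 0 < s -> 0 < b ->
  exists2 d, 0 < d & forall e, 0 <= e -> e <= d -> e `^ s <= b.
Proof.
move=> s0 b0; exists (b `^ s^-1) => [|e e0 ed]; first exact: powR_gt0.
rewrite (_ : b = (b `^ s^-1) `^ s); last first.
  by rewrite -powRrM mulVf ?gt_eqF// powRr1// ltW.
by apply: ge0_ler_powR; rewrite ?nnegrE ?powR_ge0// ltW.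
Qed.

(** Since [N (h ^ p) = N (h ^ q) h ^ (p - q)] and [N h = N (h ^ q) h ^ (1 - q)],
    fixing [N (h ^ q)] up to a factor and letting [h] tend to [0] sends the
    former to infinity and the latter to [0]. Lower bounds are stated at [h / 2],
    the level that one of two summands of [h] must reach. *)
Lemma block_parameters p q Q P c : 0 <= p -> p < q -> q < 1 -> 0 < Q -> 0 < c ->
  exists (h : R) (n : nat), [/\ 0 < h, (0 < n)%N,
    2 * Q <= n%:R * gauge q (h / 2) /\ n%:R * gauge q h <= 6 * Q,
    P <= n%:R * gauge p (h / 2) & n%:R * h <= c].
Proof.
move=> p0 pq q1 Q0 c0; have q0 : 0 < q by exact: le_lt_trans pq.
have [d1 d1_gt0 d1P] := powR_small q0 Q0.
have qp0 : 0 < q - p by rewrite subr_gt0.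
have P'0 : 0 < Num.max P 1 by rewrite lt_max ltr01 orbT.
have [d2 d2_gt0 d2P] : exists2 d, 0 < d & forall e, 0 <= e -> e <= d ->
    e `^ (q - p) <= 2 * Q / Num.max P 1.
  by apply: powR_small => //; rewrite divr_gt0 ?mulr_gt0.
have q10 : 0 < 1 - q by rewrite subr_gt0.
have [d3 d3_gt0 d3P] : exists2 d, 0 < d & forall e, 0 <= e -> e <= d ->
    e `^ (1 - q) <= c / (6 * Q).
  by apply: powR_small => //; rewrite divr_gt0 ?mulr_gt0.
(* [d] is half of the block height; [d1] bounds the rounding error of the length *)
pose d := Num.min d1 (Num.min d2 d3).
have d0 : 0 < d by rewrite !lt_min d1_gt0 d2_gt0.
have dq : d `^ q <= Q by apply: d1P; rewrite ?(ltW d0)// ge_min lexx.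
have dqp : d `^ (q - p) <= 2 * Q / Num.max P 1.
  by apply: d2P; rewrite ?(ltW d0)// !ge_min lexx orbT.
have dq1 : d `^ (1 - q) <= c / (6 * Q).
  by apply: d3P; rewrite ?(ltW d0)// !ge_min lexx !orbT.
have dq0 : 0 < d `^ q by exact: powR_gt0.
pose n := (Num.truncn (2 * Q / d `^ q)).+1.
have Qdq0 : 0 <= 2 * Q / d `^ q by rewrite divr_ge0 ?mulr_ge0 ?(ltW Q0) ?(ltW dq0).
have nlow : 2 * Q <= n%:R * d `^ q.
  by rewrite -ler_pdivrMr// ltW// truncnS_gt.
have nup : n%:R * d `^ q <= 3 * Q.
  rewrite /n -natr1 mulrDl mul1r (_ : 3 * Q = 2 * Q + Q); last by ring.
  by rewrite lerD// -ler_pdivlMr// truncn_le.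
have n0 : 0 <= n%:R :> R by [].
exists (2 * d), n; rewrite mulrAC divff// mul1r.
have gd r : gauge r d = d `^ r by rewrite /gauge gt_eqF// gtr0_norm.
rewrite gaugeM !gd; split=> //; first by rewrite mulr_gt0.
- split=> //; rewrite mulrCA (_ : 6 * Q = 2 * (3 * Q)); last by ring.
  apply: ler_pM; rewrite ?mulr_ge0 ?gauge_ge0 ?(ltW dq0)//.
  rewrite gauge_powR// ger0_norm// -[leRHS]powRr1// ler_powR ?ler1n//.
  exact: ltW.
- have dE : d `^ q = d `^ p * d `^ (q - p).
    by rewrite -powRD ?subrKC// (gt_eqF d0) implybT.
  apply: (@le_trans _ _ (Num.max P 1)); first by rewrite le_max lexx.
  rewrite -(@ler_pM2r _ (d `^ (q - p))) ?powR_gt0// -mulrA -dE.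
  by apply: le_trans nlow; rewrite mulrC -ler_pdivlMr.
- have dE : d = d `^ q * d `^ (1 - q).
    by rewrite -powRD ?subrKC ?powRr1 ?(ltW d0)// (gt_eqF d0) implybT.
  rewrite (_ : n%:R * (2 * d) = 2 * (n%:R * d `^ q * d `^ (1 - q))); last first.
    by rewrite -mulrA -dE mulrCA.
  apply: (@le_trans _ _ (2 * (3 * Q * (c / (6 * Q))))).
    by rewrite ler_pM2l// ler_pM ?mulr_ge0 ?powR_ge0.
  by rewrite le_eqVlt; apply/predU1l; field; rewrite gt_eqF.
Qed.

Definition block_start N j := (\sum_(0 <= i < j) N i)%N.

Definition is_block_sequence N h x :=
  forall j k, (block_start N j <= k < block_start N j.+1)%N -> x k = h j.

Lemma block_startS N j : block_start N j.+1 = (block_start N j + N j)%N.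
Proof. by rewrite /block_start big_nat_recr. Qed.

Lemma block_start0 N : block_start N 0 = 0%N.
Proof. by rewrite /block_start big_nil. Qed.

Lemma leq_block_start N : {homo block_start N : i j / (i <= j)%N}.
Proof.
apply: homo_leq => // [j i k|j]; first exact: leq_trans.
by rewrite block_startS leq_addr.
Qed.

Lemma block_start_ge N : (forall j, 0 < N j)%N -> forall j, (j <= block_start N j)%N.
Proof.
move=> N0; elim=> // j ih; rewrite block_startS -addn1.
by rewrite leq_add.
Qed.

Lemma block_sequence_exists N h : (forall j, 0 < N j)%N ->
  exists x, is_block_sequence N h x.
Proof.
move=> N0.
have /choice[b bP] : forall k, exists j,
    (block_start N j <= k < block_start N j.+1)%N.
  move=> k; have [|j kj jmin] := @ex_minnP (fun j => (k < block_start N j.+1)%N).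
    by exists k; exact: block_start_ge.
  exists j; rewrite kj andbT; case: j kj jmin => [|j] _ jmin.
    by rewrite block_start0.
  by rewrite leqNgt; apply/negP => /jmin; rewrite ltnn.
exists (h \o b) => j k /andP[jk kj] /=; congr h.
have /andP[bk kb] := bP k; apply/eqP; rewrite eqn_leq; apply/andP; split.
  rewrite leqNgt; apply/negP => /(@leq_block_start N)/leq_trans/(_ bk).
  by rewrite leqNgt kj.
rewrite leqNgt; apply/negP => /(@leq_block_start N)/leq_trans/(_ jk).
by rewrite leqNgt kb.
Qed.

Lemma sum_block_sequence N h x (F : R -> R) i j : is_block_sequence N h x ->
  (i <= j)%N ->
  \sum_(block_start N i <= k < block_start N j) F (x k) =
  \sum_(i <= l < j) (N l)%:R * F (h l).
Proof.
move=> xN; elim: j => [|j ih]; first by rewrite leqn0 => /eqP->; rewrite !big_geq.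
rewrite leq_eqVlt => /predU1P[->|]; first by rewrite !big_geq.
rewrite ltnS => ij; rewrite (big_cat_nat (n := block_start N j))//=; last 2 first.
- exact: leq_block_start.
- exact: leq_block_start.
rewrite big_nat_recr// ih//=; congr (_ + _).
rewrite (eq_big_nat _ _ (F2 := fun=> F (h j))); last by move=> k /xN ->.
by rewrite sumr_const_nat block_startS addKn mulr_natl.
Qed.

Lemma half_geometric_sum n : \sum_(0 <= k < n) (2 ^- k : R) <= 2.
Proof.
suff -> : \sum_(0 <= k < n) (2 ^- k : R) = 2 - 2 * 2 ^- n.
  by rewrite gerBl mulr_ge0// invr_ge0 exprn_ge0.
elim: n => [|n ih]; first by rewrite big_nil expr0 invr1 mulr1 subrr.
by rewrite big_nat_recr//= ih exprS; field; rewrite expf_neq0.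
Qed.

Lemma ell_block_sequence q N h x M : 0 <= q -> (forall j, 0 < N j)%N ->
  is_block_sequence N h x ->
  (forall j, (N j)%:R * gauge q (h j) <= M * 2 ^- j) -> ell q x.
Proof.
move=> q0 N0 xN hM; have M0 : 0 <= M.
  have := hM 0%N; rewrite expr0 invr1 mulr1; apply: le_trans.
  by rewrite mulr_ge0 ?gauge_ge0.
apply/ell_modular => //; apply: (@le_lt_trans _ _ (M * 2)%:E); last by rewrite ltry.
apply/modular_leP => n.
apply: (@le_trans _ _ (\sum_(0 <= k < block_start N n) gauge q (x k))).
  rewrite [leRHS](big_cat_nat (n := n))//=; last exact: block_start_ge.
  by rewrite lerDl sumr_ge0// => k _; exact: gauge_ge0.
rewrite -{1}(block_start0 N) (sum_block_sequence _ xN)//.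
apply: le_trans (ler_sum _ (fun k _ => hM k)) _.
by rewrite -mulr_sumr ler_wpM2l// half_geometric_sum.
Qed.

Lemma not_ell_block_sequence p N h x : 0 <= p -> is_block_sequence N h x ->
  (forall j, 1 <= (N j)%:R * gauge p (h j)) -> ~ ell p x.
Proof.
move=> p0 xN h1 /(ell_modular _ p0)/ereal_lt_pinfty_le[M M0 /modular_leP xM].
have := xM (block_start N (Num.truncn M).+1).
apply/negP; rewrite -ltNge; apply: lt_le_trans (truncnS_gt _) _.
rewrite -{1}(block_start0 N) (sum_block_sequence _ xN)//.
rewrite -[leLHS]mulr1 mulr_natl -[X in _ *+ X]subn0 -sumr_const_nat.
by apply: ler_sum.
Qed.

(** Blocks of size [2 ^- j] in [ell q] and at least [1] in [ell p]. *)
Lemma ell_proper_sub p q : 0 <= p -> p < q -> q < 1 ->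
  exists y : nat -> R, ell q y /\ ~ ell p y.
Proof.
move=> p0 pq q1.
have /choice[hn hnP] : forall j : nat, exists hn : R * nat,
    [/\ (0 < hn.2)%N, hn.2%:R * gauge q hn.1 <= 6 * 2 ^- j &
        1 <= hn.2%:R * gauge p hn.1].
  move=> j; have Q0 : 0 < 2 ^- j :> R by rewrite invr_gt0 exprn_gt0.
  have [h [n [h0 n0 [_ hq] hp _]]] := block_parameters 1 p0 pq q1 Q0 ltr01.
  exists (h, n); split=> //=; apply: le_trans hp _.
  rewrite ler_wpM2l// le_gauge// normrM normfV (ger0_norm (ler0n _ 2)).
  by rewrite ler_piMr// invf_le1 ?ler1n.
have N0 j : (0 < (hn j).2)%N by case: (hnP j).
have [y yN] := block_sequence_exists (fun j => (hn j).1) N0.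
exists y; split.
  apply: (@ell_block_sequence q _ _ _ 6 (le_trans p0 (ltW pq)) N0 yN).
  by move=> j; case: (hnP j).
by apply: not_ell_block_sequence yN _ => // j; case: (hnP j).
Qed.

(** The height of block [j] may depend on all previous blocks through the total
    [A] of their modulars. The reserve [r j] bounds the l^1 norm of everything
    from block [j] on: each block spends at most half of it, and the next reserve
    is cut down to what [beta] demands once the new total is known. *)
Lemma block_construction p q (Q P : nat -> R) (beta : nat -> R -> R) :
  0 <= p -> p < q -> q < 1 -> (forall j, 0 < Q j) -> (forall j A, 0 < beta j A) ->
  exists h N (r : nat -> R),
    [/\ forall j, (0 < N j)%N,
        forall j, 0 < h j /\ P j <= (N j)%:R * gauge p (h j / 2),
        forall j, 2 * Q j <= (N j)%:R * gauge q (h j / 2) /\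
                  (N j)%:R * gauge q (h j) <= 6 * Q j,
        forall j, 0 < r j <= beta j (\sum_(0 <= i < j) (N i)%:R * gauge p (h i)) &
        forall j, (N j)%:R * h j + r j.+1 <= r j].
Proof.
move=> p0 pq q1 Q0 beta0.
have /choice[g gP] : forall jc : nat * R, exists hn : R * nat, 0 < jc.2 ->
    [/\ 0 < hn.1, (0 < hn.2)%N,
    2 * Q jc.1 <= hn.2%:R * gauge q (hn.1 / 2) /\
      hn.2%:R * gauge q hn.1 <= 6 * Q jc.1,
    P jc.1 <= hn.2%:R * gauge p (hn.1 / 2) & hn.2%:R * hn.1 <= jc.2].
  move=> [j c]; have [c0|c0] := ltP 0 c; last by exists (0, 0%N).
  have [h [n hnP]] := block_parameters (P j) p0 pq q1 (Q0 j) c0.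
  by exists (h, n).
(* a state is a pair made of the total so far and the reserve left *)
pose next j (Ac : R * R) :=
  let hn := g (j, Ac.2 / 2) in
  let A := Ac.1 + hn.2%:R * gauge p hn.1 in
  (A, Num.min (Ac.2 / 2) (beta j.+1 A)).
pose st := fix st j := if j is j'.+1 then next j' (st j') else (0, beta 0%N 0).
pose hn j := g (j, (st j).2 / 2).
have st0 j : 0 < (st j).2.
  by elim: j => //= j ih; rewrite lt_min beta0 divr_gt0.
have hnP j := gP (j, (st j).2 / 2) (divr_gt0 (st0 j) (ltr0n _ 2)).
have stA j : (st j).1 = \sum_(0 <= i < j) (hn i).2%:R * gauge p (hn i).1.
  by elim: j => [|j ih]; rewrite ?big_nil// big_nat_recr//= ih.
exists (fun j => (hn j).1), (fun j => (hn j).2), (fun j => (st j).2).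
split=> j; try by case: (hnP j).
  by rewrite st0 -stA; case: j => [|j]//=; rewrite ge_min lexx orbT.
case: (hnP j) => _ _ _ _ /= hc; rewrite [leRHS]splitr lerD//.
by rewrite ge_min lexx.
Qed.

End blocks.

(** * A dominating sequence that no operator maps to the given one *)

Section domination.
Context {R : realType}.
Implicit Types (p q t a b c C M : R) (h x y z u v : nat -> R) (N : nat -> nat).

Lemma sum_nat_le_modular p x m n :
  ((\sum_(m <= k < n) gauge p (x k))%:E <= modular p x)%E.
Proof.
have [mn|/ltnW nm] := leqP m n; last by rewrite big_geq// modular_ge0.
apply: le_trans (sum_le_modular p x n); rewrite lee_fin.
rewrite [leRHS](big_cat_nat (n := m))//= lerDr sumr_ge0// => k _.
exact: gauge_ge0.
Qed.

(** Where [u + v = b], one of [u] and [v] is at least [b / 2] in absolute value,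
    so one of them is so at half of the indices at least. The count is made by
    adding the normalized gauges, each index contributing at least [1]. *)
Lemma split_constant_block p q (b : R) u v m n : 0 <= p -> 0 <= q -> 0 < b ->
  (forall k, (m <= k < m + n)%N -> u k + v k = b) ->
  n%:R * gauge p (b / 2) <= 2 * \sum_(m <= k < m + n) gauge p (u k) \/
  n%:R * gauge q (b / 2) <= 2 * \sum_(m <= k < m + n) gauge q (v k).
Proof.
move=> p0 q0 b0 uvb; set U := \sum_(_ <= k < _) _; set V := \sum_(_ <= k < _) _.
have b20 : b / 2 != 0 by rewrite gt_eqF// divr_gt0.
have Gp := gauge_gt0 p b20; have Gq := gauge_gt0 q b20.
have : n%:R <= U / gauge p (b / 2) + V / gauge q (b / 2).
  rewrite /U /V !mulr_suml -big_split/= -{1}(addKn m n).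
  rewrite -[leLHS]mulr1 mulr_natl -sumr_const_nat.
  apply: ler_sum_nat => k /uvb uvk.
  have b2 : `|b / 2| = b / 2 by rewrite gtr0_norm// divr_gt0.
  have [bu|bu] := leP (b / 2) `|u k|.
    apply: ler_wpDr; first by rewrite divr_ge0 ?gauge_ge0.
    by rewrite ler_pdivlMr// mul1r le_gauge// b2.
  apply: ler_wpDl; first by rewrite divr_ge0 ?gauge_ge0.
  rewrite ler_pdivlMr// mul1r le_gauge// b2.
  have := ler_normD (u k) (v k); rewrite uvk (gtr0_norm b0); lra.
have [?|Un] := leP (n%:R * gauge p (b / 2)) (2 * U); first by left.
have [?|Vn] := leP (n%:R * gauge q (b / 2)) (2 * V); first by right.
have : U / gauge p (b / 2) < n%:R / 2 by rewrite ltr_pdivrMr//; lra.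
have : V / gauge q (b / 2) < n%:R / 2 by rewrite ltr_pdivrMr//; lra.
lra.
Qed.

(** The first block on which [v] carries half of its size tells where to cut [y].
    Such a block exists since [u] is in [ell p]: the term [j%:R] makes the blocks
    of [x] unbounded in [ell p]. For the first block there is no previous one to
    take care of the head of [y], which is why the cut [n 0] has to be [0]. *)
Lemma dominating_split p q N h x y (n : nat -> nat) : 0 <= p -> 0 <= q ->
  (forall j, 0 < h j) -> is_block_sequence N h x -> n 0%N = 0%N ->
  (forall j, (modular q (cut_tail (n j) y) <=
              ((N j)%:R * gauge q (h j / 2) / 2)%:E)%E) ->
  (forall j, \sum_(0 <= k < n j.+1) gauge p (y k) + j%:R <=
             (N j)%:R * gauge p (h j / 2) / 2) ->
  forall u v, ell p u -> x = (fun k => u k + v k) ->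
    exists j, (modular p (cut_head (n j) y) <= modular p u)%E /\
              (modular q (cut_tail (n j) y) <= modular q v)%E.
Proof.
move=> p0 q0 h0 xN n0 yq yp u v up xuv.
pose U j := \sum_(block_start N j <= k < block_start N j.+1) gauge p (u k).
pose V j := \sum_(block_start N j <= k < block_start N j.+1) gauge q (v k).
have UV j : (N j)%:R * gauge p (h j / 2) <= 2 * U j \/
            (N j)%:R * gauge q (h j / 2) <= 2 * V j.
  rewrite /U /V block_startS; apply: split_constant_block => // k kj.
  by rewrite -(xN j k) ?block_startS// xuv.
have yU j : (N j)%:R * gauge p (h j / 2) <= 2 * U j ->
    \sum_(0 <= k < n j.+1) gauge p (y k) + j%:R <= U j.
  by move=> NU; apply: le_trans (yp j) _; lra.
have [j Vj] : exists j, (N j)%:R * gauge q (h j / 2) <= 2 * V j.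
  apply: contrapT => /forallNP noV.
  have [M M0 uM] := ereal_lt_pinfty_le ((ell_modular _ p0).1 up).
  set j := (Num.truncn M).+1.
  have := le_trans (sum_nat_le_modular p u _ _ : ((U j)%:E <= _)%E) uM.
  rewrite lee_fin; have [/yU|/noV] := UV j; last by [].
  have := truncnS_gt M; rewrite -/j.
  have : 0 <= \sum_(0 <= k < n j.+1) gauge p (y k).
    by apply: sumr_ge0 => k _; exact: gauge_ge0.
  lra.
have [|{Vj}j Vj jmin] :=
  @ex_minnP (fun j => (N j)%:R * gauge q (h j / 2) <= 2 * V j).
  by exists j.
exists j; split; last first.
  apply: le_trans (yq j) _.
  apply: le_trans (sum_nat_le_modular _ _ _ _ : ((V j)%:E <= _)%E).
  by rewrite lee_fin ler_pdivrMr// [leRHS]mulrC.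
case: j Vj jmin => [|j] _ jmin.
  by rewrite modular_head n0 big_nil modular_ge0.
have [/yU NU|/jmin] := UV j; last by rewrite ltnn.
apply: le_trans (sum_nat_le_modular p u _ _ : ((U j)%:E <= _)%E).
rewrite modular_head lee_fin; apply: le_trans NU.
by rewrite lerDl.
Qed.

(** The first cut has to be at [0], whence the constant [M], which bounds the
    modular of [y]. *)
Lemma tail_cutoffs q y : (modular q y < +oo)%E ->
  exists (M : R) (n : nat -> nat), [/\ 0 < M, n 0%N = 0%N &
    forall j, (modular q (cut_tail (n j) y) <= (M * 2 ^- j)%:E)%E].
Proof.
move=> yq; have [M M0 yM] := ereal_lt_pinfty_le yq.
have /choice[n nP] : forall j, exists n,
    (modular q (cut_tail n y) <= (M * 2 ^- j)%:E)%E.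
  by move=> j; apply: modular_tail_small; rewrite // divr_gt0 ?exprn_gt0.
exists M, (fun j => if j is 0 then 0%N else n j); split=> // -[|j//].
rewrite expr0 invr1 mulr1 (_ : cut_tail 0 y = y)//; exact/funext.
Qed.

(** The l^1 norms of the blocks telescope against the reserves. *)
Lemma sum_tail_block_sequence N h x (r : nat -> R) j n :
  (forall j, 0 < N j)%N -> (forall j, 0 < h j) -> (forall j, 0 < r j) ->
  is_block_sequence N h x -> (forall j, (N j)%:R * h j + r j.+1 <= r j) ->
  \sum_(0 <= k < n) `|cut_tail (block_start N j) x k| <= r j.
Proof.
move=> N0 h0 r0 xN hr; set s := block_start N j.
have sJ : (s <= block_start N (j + n))%N by apply: leq_block_start; exact: leq_addr.
have nJ : (n <= block_start N (j + n))%N.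
  by rewrite (leq_trans _ (block_start_ge N0 _))// leq_addl.
apply: (@le_trans _ _ (\sum_(0 <= k < block_start N (j + n)) `|cut_tail s x k|)).
  by rewrite [leRHS](big_cat_nat (n := n))//= lerDl sumr_ge0.
rewrite (big_cat_nat (n := s))//= big_nat big1 ?add0r => [|k /andP[_ ks]]; last first.
  by rewrite /cut_tail ks normr0.
rewrite (eq_big_nat _ _ (F2 := fun k => `|x k|)); last first.
  by move=> k /andP[sk _]; rewrite /cut_tail ltnNge sk.
rewrite (sum_block_sequence (fun a => `|a|) xN) ?leq_addr//.
apply: (@le_trans _ _ (r j - r (j + n)%N)); last by rewrite gerBl ltW.
elim: n {sJ nJ} => [|n ih]; first by rewrite addn0 big_geq// subrr.
rewrite addnS big_nat_recr ?leq_addr//= gtr0_norm//.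
have := hr (j + n)%N; lra.
Qed.

(** The choice of the blocks in terms of [y] alone; the operator comes last, and
    its bounds decide how many blocks are put into the head of [x]. *)
Lemma dominating_sequence p q y : 0 <= p -> p < q -> q < 1 ->
  ell q y -> ~ ell p y ->
  exists x, [/\ ell q x,
    forall t, 0 < t -> (Kfunctional p q t y <= Kfunctional p q t x)%E &
    forall T, ell_operators p q T -> T x <> y].
Proof.
move=> p0 pq q1 yq yp; have q_gt0 := le_lt_trans p0 pq; have q0 := ltW q_gt0.
have p1 : p <= 1 by rewrite ltW// (lt_trans pq).
have [M [n [M0 n0 nP]]] := tail_cutoffs ((ell_modular _ q0).1 yq).
have /choice[d dP] : forall B, exists d, 0 < d /\ forall u,
    (forall k, `|y k - u k| <= d) -> (B%:E < modular p u)%E.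
  by move=> B; have [d] := uniform_distance_to_balls p0 p1 yp B; exists d.
(* [A] will be the modular of the first [j] blocks; the factors [j.+1] beat the
   unknown bounds of an operator, for [p] and for [q] respectively *)
pose beta j A := d (j.+1%:R * A) / j.+1%:R.
have beta0 j A : 0 < beta j A by rewrite divr_gt0//; case: (dP (j.+1%:R * A)).
pose P j := 2 * (\sum_(0 <= k < n j.+1) gauge p (y k) + j%:R).
have Q0 j : 0 < M * 2 ^- j by rewrite divr_gt0// exprn_gt0.
have [h [N [r [N0 hP hQ r0 hr]]]] := block_construction P p0 pq q1 Q0 beta0.
have h0 j : 0 < h j by case: (hP j).
have [x xN] := block_sequence_exists h N0.
have xq : ell q x.
  apply: (ell_block_sequence (M := 6 * M) q0 N0 xN) => j.
  by rewrite -mulrA; case: (hQ j).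
exists x; split=> //.
  apply: Kfunctional_le => // u v up vq xuv.
  have [||j [ypu yqv]] := dominating_split (y := y) p0 q0 h0 xN n0 _ _ up xuv.
  - move=> j; apply: le_trans (nP j) _; rewrite lee_fin ler_pdivlMr// mulrC.
    by case: (hQ j).
  - by move=> j; rewrite ler_pdivlMr// mulrC; case: (hP j).
  - by exists (cut_head (n j) y), (cut_tail (n j) y); rewrite headDtail; split.
move=> T [Tlin Tq Tp] Txy.
have T0 : T (cst 0) = cst 0 by apply: linear_on_cst0 Tlin _; exact: ell_cst0.
have [Cp Cp0 TCp] := (bounded_on_ell_modular p0 T0).1 Tp.
have [Cq Cq0 TCq] := sup_norm_bounded_by_sum q_gt0 Tlin Tq.
pose j := Num.truncn (Num.max Cp Cq); pose s := block_start N j.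
have Cj : Num.max Cp Cq <= j.+1%:R by rewrite ltW// truncnS_gt.
have [Cpj Cqj] : Cp <= j.+1%:R /\ Cq <= j.+1%:R.
  by move: Cj; rewrite ge_max => /andP.
set A := \sum_(0 <= i < j) (N i)%:R * gauge p (h i) in r0.
have Ax : modular p (cut_head s x) = A%:E.
  by rewrite modular_head -{1}(block_start0 N) (sum_block_sequence _ xN).
(* [T (cut_head s x)] is too close to [y] for an element of its ball *)
have [_ /(_ (T (cut_head s x)))] := dP (j.+1%:R * A).
rewrite ltNge => /(_ _)/negP; apply.
  move=> k; rewrite -Txy (linear_on_headDtail s k q0 Tlin xq) addrAC subrr add0r.
  apply: le_trans (TCq _ _ (ell_tail _ q0 xq) _ _) _.
    move=> m; apply: (sum_tail_block_sequence _ _ N0 h0 _ xN hr).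
    by move=> i; case/andP: (r0 i).
  have /andP[rj0 rj] := r0 j.
  apply: (@le_trans _ _ (j.+1%:R * beta j A)); last first.
    by rewrite /beta mulrCA divff ?mulr1.
  by rewrite ler_pM// ltW.
apply: le_trans (TCp _ (ell_head _ _ p0)) _.
rewrite Ax -EFinM lee_fin ler_wpM2r// sumr_ge0// => i _.
by rewrite mulr_ge0 ?gauge_ge0.
Qed.

End domination.

Unset Implicit Arguments.

Theorem theorem5p2 (R : realType) (p q : R)
    (p_ge0 : 0 <= p) (p_lt_q : p < q) (q_lt1 : q < 1) :
  CM p q = ell p /\ ~ CM_couple p q.
Proof.
have q_ge0 : 0 <= q by rewrite (le_trans p_ge0)// ltW.
split.
  apply/seteqP; split; last exact: ell_sub_CM.
  move=> y [yq yCM]; apply: contrapT => yp.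
  have [x [xq Kyx noT]] := dominating_sequence p_ge0 p_lt_q q_lt1 yq yp.
  by have [T Tpq /noT] := yCM x xq Kyx; exact.
move=> couple; have [y [yq yp]] := ell_proper_sub p_ge0 p_lt_q q_lt1.
have [x [xq Kyx noT]] := dominating_sequence p_ge0 p_lt_q q_lt1 yq yp.
have x0 : x <> cst 0.
  (* otherwise [y], having smaller K-functional than [0], would be [0] *)
  move=> x0; have y0 : y <> cst 0.
    by move=> y0; apply: yp; rewrite y0; exact: ell_cst0.
  have := Kyx 1 ltr01; rewrite x0 leNgt => /negP; apply.
  by rewrite (le_lt_trans (Kfunctional_cst0 _ _ _))// Kfunctional_gt0.
have [|T Tpq yT] := couple x y xq x0 yq; last exact: noT Tpq (esym yT).
apply: (@le_lt_trans _ _ 1%E); last by rewrite ltry.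
apply: ge_ereal_sup => _ [t /= t0 <-].
have := Kfunctional_gt0 p_ge0 q_ge0 t0 x0; have := Kyx t t0.
have := Kfunctional_ge0 p q y t0.
case: (Kfunctional p q t x) => [a Ky0 Kya|Ky0 _ _|//].
  by rewrite lte_fin => a0; rewrite inver gt_eqF// lee_pdivrMr// mul1e.
by rewrite invey mule0 lee01.
Qed.
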